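(* Let $D$ be a real $m\times p$ matrix, let $S\subseteq\mathbb{R}^m$ be a closed convex set, let $T=D^{-1}(S)=\{x\in\mathbb{R}^p: Dx\in S\}$, and suppose the convex function $f$ on $\mathbb{R}^p$ possesses a unique minimum point on the closed convex set $T$. (i) For all sufficiently large $\rho$, every surrogate $$g_\rho(x\mid x_n)=f(x)+\frac{\rho}{2}\|Dx-\mathcal{P}(Dx_n)\|^2$$ is coercive as a function of $x$ and therefore attains its minimum value. (ii) If $$f(x)\ \ge\ f(x_n)+v_n^t(x-x_n)+\frac12 (x-x_n)^tA(x-x_n)$$ for all $x$ and some positive semidefinite matrix $A$ and subgradient $v_n$ of $f$ at $x_n$, and if the inequality $u^tAu>0$ holds whenever $\|Du\|=0$ and $u\neq 0$, then for $\rho$ sufficiently large, $g_\rho(x\mid x_n)$ is strongly convex in $x$ and hence coercive.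
   Context: The point $x_n\in\mathbb{R}^p$ is the current iterate, at which the surrogate $g_\rho(\cdot\mid x_n)$ is anchored. $\mathcal{P}(z)$ denotes the Euclidean projection of $z\in\mathbb{R}^m$ onto $S$. A function on $\mathbb{R}^p$ is coercive if it tends to $\infty$ as $\|x\|\to\infty$. A function $g$ is strongly convex if $g-\frac{\mu}{2}\|\cdot\|^2$ is convex for some $\mu>0$.
   Formalization: In (ii) the quadratic lower bound is assumed at every point x_n, with one matrix A for all of them and v_n depending on x_n; assumed at a single x_n only, strong convexity can fail, e.g. D = 0, S = R, f(x) = max(|x|, x^2), x_n = 0, A = 1. *)

(* Defs.v *)
From HB Require Import structures.
From mathcomp Require Import all_boot all_order all_algebra.
From mathcomp Require Import boolp classical_sets reals topology normedtype convex.

Set Implicit Arguments.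
Unset Strict Implicit.
Unset Printing Implicit Defensive.

Import Order.TTheory GRing.Theory Num.Theory.
Import numFieldNormedType.Exports.

Local Open Scope classical_set_scope.
Local Open Scope ring_scope.

(* The library's norm on matrices is the sup norm, hence a separate Euclidean
   norm; the library's topology on 'cV[R]_n is nevertheless the usual one. *)
Definition enorm (R : realType) (n : nat) (u : 'cV[R]_n) : R :=
  Num.sqrt (\sum_(i < n) u i 0 ^+ 2).

Definition dotv (R : realType) (n : nat) (u v : 'cV[R]_n) : R :=
  (u^T *m v) 0 0.

Definition quadf (R : realType) (n : nat) (A : 'M[R]_n) (u : 'cV[R]_n) : R :=
  (u^T *m A *m u) 0 0.

Definition possemidef (R : realType) (n : nat) (A : 'M[R]_n) : Prop :=
  A^T = A /\ forall u : 'cV[R]_n, 0 <= quadf A u.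

Definition minimizer (R : realType) (n : nat) (g : 'cV[R]_n -> R)
    (T : set 'cV[R]_n) (y : 'cV[R]_n) : Prop :=
  T y /\ forall x, T x -> g y <= g x.

(* For closed convex nonempty S the minimizer exists and is unique, so that the
   default value z of xget is never used. *)
Definition eproj (R : realType) (n : nat) (S : set 'cV[R]_n) (z : 'cV[R]_n) :
    'cV[R]_n :=
  xget z [set w | minimizer (fun s => enorm (z - s)) S w].

Definition coercive (R : realType) (n : nat) (g : 'cV[R]_n -> R) : Prop :=
  forall M : R, \forall r \near +oo, forall x : 'cV[R]_n,
    r <= enorm x -> M <= g x.

Definition strongly_convex (R : realType) (n : nat) (g : 'cV[R]_n -> R) :
    Prop :=
  exists2 mu : R, 0 < mu &
    convex_function [set: 'cV[R]_n] (fun x => g x - mu / 2 * enorm x ^+ 2).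

Definition subgradient (R : realType) (n : nat) (f : 'cV[R]_n -> R)
    (z v : 'cV[R]_n) : Prop :=
  forall x, f z + dotv v (x - z) <= f x.

Definition surrogate (R : realType) (m p : nat) (f : 'cV[R]_p -> R)
    (D : 'M[R]_(m, p)) (S : set 'cV[R]_m) (rho : R) (xn x : 'cV[R]_p) : R :=
  f x + rho / 2 * enorm (D *m x - eproj S (D *m xn)) ^+ 2.

(* Main.v *)
(* Every [rho > 0] works. At the minimizer [y] of [f] on [T], a direction [u]
   with [D u = 0] stays in [T], so [f] strictly increases along it, and by
   convexity at least linearly; a direction with [D u != 0] makes the penalty
   grow quadratically while [f] decreases at most linearly. Compactness of the
   unit sphere makes this uniform, whence coercivity. For (ii), [A + rho D^T D]
   is positive definite, so after subtracting [mu / 2 |x|^2] the surrogate still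
   has an affine minorant touching it at every point. *)
Require Import Defs.
From HB Require Import structures.
From mathcomp Require Import all_boot all_order all_algebra.
From mathcomp Require Import boolp classical_sets reals topology normedtype convex.
From mathcomp Require Import interval_inference derive ring lra.

Set Implicit Arguments.
Unset Strict Implicit.
Unset Printing Implicit Defensive.

Import Order.TTheory GRing.Theory Num.Theory.
Import numFieldNormedType.Exports.

Local Open Scope classical_set_scope.
Local Open Scope ring_scope.

(** * Finite convex functions: growth along rays, and continuity *)

Lemma convex_functionP (R : realType) (n : nat) (f : 'cV[R]_n -> R) :
  convex_function [set: 'cV[R]_n] f <->
  forall t x y, 0 <= t -> t <= 1 ->
    f (t *: x + (1 - t) *: y) <= t * f x + (1 - t) * f y.
Proof.
split => [cf t x y t0 t1|cf t x y _ _]; last exact: cf.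
have := cf (Itv01 t0 t1) x y; rewrite !inE; exact.
Qed.

(** The point [y + u] is the convex combination of [y + t *: u] and [y] with weight [t^-1] on the
    first. An increase over a unit step thus propagates at least linearly. *)
Lemma convex_ray (R : realType) (n : nat) (f : 'cV[R]_n -> R) y u (t : R) :
  convex_function [set: 'cV[R]_n] f -> 1 <= t ->
  f y + t * (f (y + u) - f y) <= f (y + t *: u).
Proof.
move=> /convex_functionP cf t1; have t0 : 0 < t by rewrite (lt_le_trans _ t1).
have := cf t^-1 (y + t *: u) y; rewrite invr_ge0 (ltW t0) invf_le1//.
move=> /(_ isT t1); rewrite scalerDr scalerA mulVf ?gt_eqF// scale1r.
rewrite addrAC -scalerDl subrKC scale1r => le_fyu.
rewrite -(ler_pM2l (x := t^-1)) ?invr_gt0//.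
rewrite mulrDr mulrA mulVf ?gt_eqF// mul1r; lra.
Qed.

Lemma convex_midpoint (R : realType) (n : nat) (f : 'cV[R]_n -> R) x a b :
  convex_function [set: 'cV[R]_n] f ->
  2 * f (x + (a + b)) <= f (x + 2 *: a) + f (x + 2 *: b).
Proof.
move=> /convex_functionP cf; have := cf 2^-1 (x + 2 *: a) (x + 2 *: b).
have -> : 1 - 2^-1 = 2^-1 :> R by field.
rewrite !scalerDr !scalerA mulVf// !scale1r addrACA -scalerDl.
have -> : 2^-1 + 2^-1 = 1 :> R by field.
rewrite scale1r; have h0 : 0 <= 2^-1 :> R by lra.
have h1 : 2^-1 <= 1 :> R by lra.
by move=> /(_ h0 h1); lra.
Qed.

(** On the segments from [x] to [x + u] and to [x - u], [f] lies below its chords, so its increase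
    is at most proportional to the parameter. *)
Lemma convex_usc_line (R : realType) (n : nat) (f : 'cV[R]_n -> R) x u (e : R) :
  convex_function [set: 'cV[R]_n] f -> 0 < e ->
  exists2 d : R, 0 < d & forall a, `|a| <= d -> f (x + a *: u) <= f x + e.
Proof.
move=> /convex_functionP cf e0.
(* [C] dominates the slopes of both chords; the summand 1 makes it a legitimate divisor. *)
pose C := `|f (x + u) - f x| + `|f (x - u) - f x| + 1.
have C0 : 0 < C by rewrite ltr_pwDr// addr_ge0.
have ubC v : v = u \/ v = - u -> f (x + v) - f x <= C.
  have := ler_norm (f (x + u) - f x); have := ler_norm (f (x - u) - f x).
  have := normr_ge0 (f (x + u) - f x); have := normr_ge0 (f (x - u) - f x).
  by rewrite /C => ? ? ? ? [->|->]; lra.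
have dir t v : v = u \/ v = - u -> 0 <= t -> t <= 1 -> t <= e / C ->
    f (x + t *: v) <= f x + e.
  move=> /ubC vC t0 t1 te; have := cf t (x + v) x t0 t1.
  rewrite scalerDr addrAC -scalerDl subrKC scale1r addrC => fv.
  have : t * C <= e by rewrite -ler_pdivlMr.
  have : t * (f (x + v) - f x) <= t * C by rewrite ler_wpM2l.
  lra.
exists (Num.min 1 (e / C)); first by rewrite lt_min ltr01 divr_gt0.
move=> a; rewrite le_min => /andP[a1 ae]; have [a0|a0] := leP 0 a.
  by apply: dir; rewrite ?ger0_norm// in a1 ae *; left.
rewrite -[a *: u]opprK -scaleNr -scalerN.
by apply: dir; rewrite ?ltr0_norm// in a1 ae *; [right|lra].
Qed.

(** The displacement is split into its coordinates and these are treated one at a time: by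
    [convex_midpoint], a bound along one axis and a bound for the remaining sum combine into a bound
    for the total. *)
Lemma convex_usc (R : realType) (n : nat) (f : 'cV[R]_n -> R) x (e : R) :
  convex_function [set: 'cV[R]_n] f -> 0 < e ->
  exists2 d : R, 0 < d & forall h, `|h| <= d -> f (x + h) <= f x + e.
Proof.
move=> cf e0.
have part (s : seq 'I_n) : exists2 d : R, 0 < d & forall h : 'I_n -> R,
    (forall i, `|h i| <= d) ->
    f (x + \sum_(i <- s) h i *: delta_mx i 0) <= f x + e.
  elim: s => [|i s [d d0 fd]].
    by exists 1 => // h _; rewrite big_nil addr0; lra.
  have [c c0 fc] := convex_usc_line x (delta_mx i 0) cf e0.
  (* Passing to the midpoint doubles both displacements, hence the halved radius. *)
  exists (Num.min c d / 2) => [|h hcd]; first by rewrite divr_gt0// lt_min c0.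
  have twice j : `|2 * h j| <= Num.min c d.
    by rewrite normrM ger0_norm//; have := hcd j; lra.
  rewrite big_cons.
  have := convex_midpoint x (h i *: delta_mx i 0)
    (\sum_(j <- s) h j *: delta_mx j 0) cf.
  rewrite scalerA scaler_sumr (eq_bigr _ (fun j _ => scalerA 2 (h j) _)).
  have := fc (2 * h i); have := fd (fun j => 2 * h j).
  have := twice i; rewrite le_min => /andP[-> _].
  have twiced j : `|2 * h j| <= d.
    by rewrite (le_trans (twice j))// ge_min lexx orbT.
  by move=> /(_ twiced) ? /(_ isT) ?; lra.
have [d d0 fd] := part (index_enum 'I_n).
exists d => // h hd.
have -> : h = \sum_i h i 0 *: delta_mx i 0.
  rewrite {1}(matrix_sum_delta h); apply: eq_bigr => i _.
  by rewrite big_ord1.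
apply: fd => i; apply: le_trans hd.
rewrite [leRHS]/Num.norm/= mx_normrE.
by rewrite (le_bigmax _ (fun ij => `|h ij.1 ij.2|) (i, 0)).
Qed.

(** Upper semicontinuity suffices: [x] is the midpoint of [x + h] and [x - h], so an upper bound at
    one of them forces a lower bound at the other. *)
Lemma convex_continuous (R : realType) (n : nat) (f : 'cV[R]_n -> R) :
  convex_function [set: 'cV[R]_n] f -> continuous f.
Proof.
move=> cf x; apply/(@cvgrPdist_le _ _ _ (nbhs x) (nbhs_filter x) f (f x)).
move=> e e0.
have [d d0 fd] := convex_usc x cf e0.
apply/nbhs_ballP; exists d => //= z; rewrite -ball_normE /= => /ltW hd.
have := fd _ hd; have := fd (- (x - z)); rewrite normrN => /(_ hd).
rewrite opprB [x + (z - x)]addrC subrK => hi lo.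
have := convex_midpoint x (2^-1 *: (x - z)) (2^-1 *: - (x - z)) cf.
rewrite -scalerDr subrr scaler0 addr0 !scalerA divff// !scale1r opprB.
rewrite [x + (z - x)]addrC subrK => mid.
by rewrite ler_norml; apply/andP; split; lra.
Qed.

(** * The Euclidean norm and continuity of quadratic expressions *)

Lemma enormE (R : realType) (n : nat) (u : 'cV[R]_n) :
  enorm u ^+ 2 = \sum_i u i 0 ^+ 2.
Proof. by rewrite sqr_sqrtr// sumr_ge0// => i _; rewrite sqr_ge0. Qed.

Lemma enorm_ge0 (R : realType) (n : nat) (u : 'cV[R]_n) : 0 <= enorm u.
Proof. exact: sqrtr_ge0. Qed.

Lemma enormZ (R : realType) (n : nat) (a : R) (u : 'cV[R]_n) :
  enorm (a *: u) = `|a| * enorm u.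
Proof.
rewrite /enorm -sqrtr_sqr -sqrtrM ?sqr_ge0// mulr_sumr.
by congr Num.sqrt; apply: eq_bigr => i _; rewrite mxE exprMn.
Qed.

Lemma enorm_eq0 (R : realType) (n : nat) (u : 'cV[R]_n) :
  enorm u = 0 -> u = 0.
Proof.
move=> u0; have /eqP : enorm u ^+ 2 = 0 by rewrite u0 expr0n.
rewrite enormE psumr_eq0 => [/allP ui0|i _]; last exact: sqr_ge0.
apply/colP => i; rewrite mxE; apply/eqP; rewrite -sqrf_eq0.
exact/ui0/mem_index_enum.
Qed.

Lemma enorm0 (R : realType) (n : nat) : enorm (0 : 'cV[R]_n) = 0.
Proof. by rewrite -(scale0r 0) enormZ normr0 mul0r. Qed.

Lemma enormN (R : realType) (n : nat) (u : 'cV[R]_n) : enorm (- u) = enorm u.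
Proof. by rewrite -scaleN1r enormZ normrN1 mul1r. Qed.

(* The triangle inequality up to constants, from [0 <= (a + 2 b) ^+ 2]. *)
Lemma enormD_ge (R : realType) (n : nat) (u v : 'cV[R]_n) :
  enorm u ^+ 2 / 2 - enorm v ^+ 2 <= enorm (u + v) ^+ 2.
Proof.
rewrite !enormE mulr_suml -sumrB ler_sum// => i _; rewrite mxE.
have := sqr_ge0 (u i 0 + 2 * v i 0); lra.
Qed.

Lemma mulmx_coord_continuous (R : realType) (m n : nat) (L : 'M[R]_(m, n)) i :
  continuous (fun x : 'cV[R]_n => (L *m x) i 0).
Proof.
have -> : (fun x : 'cV[R]_n => (L *m x) i 0) =
    (fun x => \sum_j L i j * x j 0) by apply/funext => x; rewrite mxE.
apply: continuous_big => [|j _ x]; first exact: add_continuous.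
by apply: continuousM; [exact: cst_continuous|exact: coord_continuous].
Qed.

Lemma enorm_affine_continuous (R : realType) (m n : nat) (L : 'M[R]_(m, n)) b :
  continuous (fun x : 'cV[R]_n => enorm (L *m x - b) ^+ 2).
Proof.
have coord i : continuous (fun x : 'cV[R]_n => (L *m x) i 0 - b i 0).
  move=> x; apply: continuousB; last exact: cst_continuous.
  exact: mulmx_coord_continuous.
have -> : (fun x : 'cV[R]_n => enorm (L *m x - b) ^+ 2) =
    (fun x => \sum_i ((L *m x) i 0 - b i 0) * ((L *m x) i 0 - b i 0)).
  apply/funext => x; rewrite enormE.
  by apply: eq_bigr => i _; rewrite !mxE expr2.
apply: continuous_big => [|i _ x]; first exact: add_continuous.
exact: (continuousM (coord i x) (coord i x)).
Qed.

Lemma enorm_continuous (R : realType) (n : nat) :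
  continuous (fun x : 'cV[R]_n => enorm x ^+ 2).
Proof.
have := @enorm_affine_continuous R n n 1%:M 0.
by under eq_fun do rewrite mul1mx subr0.
Qed.

Lemma quadf_continuous (R : realType) (n : nat) (A : 'M[R]_n) :
  continuous (quadf A).
Proof.
have -> : quadf A = (fun x => \sum_i x i 0 * (A *m x) i 0).
  apply/funext => x; rewrite /quadf -mulmxA mxE.
  by apply: eq_bigr => i _; rewrite [x^T _ _]mxE.
apply: continuous_big => [|i _ x]; first exact: add_continuous.
by apply: continuousM; [exact: coord_continuous|exact: mulmx_coord_continuous].
Qed.

(** * Compactness and attained minima *)

Lemma enorm_bounded_closed_compact (R : realType) (n : nat) (r : R)
    (K : set 'cV[R]_n) :
  (forall u, K u -> enorm u <= r) -> closed K -> compact K.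
Proof.
move=> Kr Kcl.
(* Transposition is continuous, as matrix neighbourhoods are entrywise; it carries compactness from
   row vectors to column vectors. *)
have trc (a b : nat) : continuous (@trmx R a b).
  move=> u W [P uP PW]; exists (fun i j => P j i) => [i j|v vP].
    by have := uP j i; rewrite mxE.
  by apply: PW => i j; rewrite mxE; exact: vP.
pose K' := [set v : 'rV[R]_n | K v^T].
have -> : K = @trmx R 1 n @` K'.
  apply/seteqP; split=> [u Ku|_ [v Kv <-]//].
  by exists u^T; rewrite /K' /= trmxK.
apply: continuous_compact; first exact: (continuous_subspaceT (trc _ _)).
apply: bounded_closed_compact; last first.
  exact: (preimage_closed (fun v _ => trc _ _ v) Kcl).
exists r; split; first exact: num_real.
move=> s rs v /Kr vr; have s0 : 0 <= s.
  by rewrite (le_trans (enorm_ge0 v^T))// (le_trans vr)// ltW.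
rewrite /Num.norm/= mx_normrE; apply/bigmax_leP; split=> // -[i j] _ /=.
rewrite ord1 -(ler_pXn2r (n := 2))// ?nnegrE// real_normK ?num_real//.
have : v 0 j ^+ 2 <= enorm v^T ^+ 2.
  rewrite enormE (bigD1 j)//= mxE lerDl sumr_ge0// => k _; exact: sqr_ge0.
move=> /le_trans; apply; rewrite ler_pXn2r// ?nnegrE ?enorm_ge0//.
by rewrite (le_trans vr)// ltW.
Qed.

(** The constant is the minimum of [phi] on the unit sphere. The two clauses serve functions of
    unknown sign and positive ones alike. *)
Lemma sphere_lower_bound (R : realType) (n : nat) (phi : 'cV[R]_n -> R) :
  continuous phi ->
  exists c, (forall u, enorm u = 1 -> c <= phi u) /\
    ((forall u, enorm u = 1 -> 0 < phi u) -> 0 < c).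
Proof.
move=> cphi; pose K := [set u : 'cV[R]_n | enorm u = 1].
have Kcl : closed K.
  have -> : K = (fun u => enorm u ^+ 2) @^-1` [set 1].
    apply/seteqP; split=> u /= => [->|/eqP]; first by rewrite expr1n.
    by rewrite -{1}(expr1n _ 2) eqrXn2 ?enorm_ge0// => /eqP.
  by apply: preimage_closed => [u _|]; [exact: enorm_continuous|exact: closed_eq].
have Kc : compact K by apply: (@enorm_bounded_closed_compact _ _ 1) => // u ->.
(* In dimension 0 the sphere is empty and any positive constant will do. *)
have [K0|nK] := pselect (K !=set0); last first.
  by exists 1; split=> // u u1; exfalso; apply: nK; exists u.
have [c cK cmin] := compact_EVT_min K0 Kc (continuous_subspaceT cphi).
exists (phi c); split=> [u u1|pos]; first by apply: cmin; rewrite inE.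
by apply: pos; move: cK; rewrite inE.
Qed.

(** Outside a large ball the values are at least [g 0], and 0 belongs to the ball, so the minimum
    over the ball is global. *)
Lemma coercive_minimizer (R : realType) (n : nat) (g : 'cV[R]_n -> R) :
  continuous g -> coercive g -> exists y, minimizer g setT y.
Proof.
move=> cg /(_ (g 0)) gco.
have [r [r0 gr]] : exists r, 0 <= r /\ forall x, r <= enorm x -> g 0 <= g x.
  have [r rP] := filter_ex (filterI (nbhs_pinfty_ge (num_real (0 : R))) gco).
  by exists r.
pose K := [set u : 'cV[R]_n | enorm u <= r].
have Kcl : closed K.
  have -> : K = (fun u => enorm u ^+ 2) @^-1` [set s | s <= r ^+ 2].
    by apply/funext => u; rewrite /K /= ler_pXn2r ?nnegrE ?enorm_ge0.
  by apply: preimage_closed => [u _|]; [exact: enorm_continuous|exact: closed_le].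
have Kc : compact K by exact: (@enorm_bounded_closed_compact _ _ r).
have K0 : K 0 by rewrite /K /= enorm0.
have [c _ cmin] :=
  compact_EVT_min (ex_intro _ _ K0) Kc (continuous_subspaceT cg).
exists c; split=> // x _; have [xr|/ltW rx] := leP (enorm x) r.
  by apply: cmin; rewrite inE.
by apply: le_trans (gr _ rx); apply: cmin; rewrite inE.
Qed.

(** * Inner products, quadratic forms and subgradients *)

Lemma dotvDl (R : realType) (n : nat) (u v w : 'cV[R]_n) :
  dotv (u + v) w = dotv u w + dotv v w.
Proof. by rewrite /dotv raddfD mulmxDl mxE. Qed.

Lemma dotvZl (R : realType) (n : nat) a (u w : 'cV[R]_n) :
  dotv (a *: u) w = a * dotv u w.
Proof. by rewrite /dotv linearZ -scalemxAl mxE. Qed.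

Lemma dotvDr (R : realType) (n : nat) (u v w : 'cV[R]_n) :
  dotv w (u + v) = dotv w u + dotv w v.
Proof. by rewrite /dotv mulmxDr mxE. Qed.

Lemma dotvZr (R : realType) (n : nat) a (u w : 'cV[R]_n) :
  dotv w (a *: u) = a * dotv w u.
Proof. by rewrite /dotv -scalemxAr mxE. Qed.

Lemma dotv_mulmxr (R : realType) (m n : nat) (L : 'M[R]_(m, n)) u v :
  dotv u (L *m v) = dotv (L^T *m u) v.
Proof. by rewrite /dotv trmx_mul trmxK mulmxA. Qed.

Lemma enormD_sqr (R : realType) (n : nat) (u v : 'cV[R]_n) :
  enorm (u + v) ^+ 2 = enorm u ^+ 2 + 2 * dotv u v + enorm v ^+ 2.
Proof.
rewrite !enormE /dotv mxE mulr_sumr -!big_split /=.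
by apply: eq_bigr => i _; rewrite !mxE; ring.
Qed.

Lemma quadf_add_gram (R : realType) (m n : nat) (A : 'M[R]_n)
    (L : 'M[R]_(m, n)) (rho : R) u :
  quadf (A + rho *: (L^T *m L)) u = quadf A u + rho * enorm (L *m u) ^+ 2.
Proof.
rewrite /quadf mulmxDr mulmxDl mxE -scalemxAr -scalemxAl; congr (_ + _).
rewrite mxE enormE mulmxA -trmx_mul -mulmxA mxE; congr (_ * _).
by apply: eq_bigr => i _; rewrite mxE expr2.
Qed.

Lemma quadfZ (R : realType) (n : nat) (A : 'M[R]_n) a u :
  quadf A (a *: u) = a ^+ 2 * quadf A u.
Proof.
by rewrite /quadf [(a *: u)^T]linearZ -!scalemxAl -scalemxAr !mxE mulrA expr2.
Qed.

(** The minimum of the form on the unit sphere is positive and extends to all vectors by homogeneity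
    of degree 2. *)
Lemma posdef_lower_bound (R : realType) (n : nat) (B : 'M[R]_n) :
  (forall u, u != 0 -> 0 < quadf B u) ->
  exists2 c, 0 < c & forall u, c * enorm u ^+ 2 <= quadf B u.
Proof.
move=> Bpos; have [c [cB c0]] := sphere_lower_bound (@quadf_continuous _ _ B).
exists c => [|u].
  apply: c0 => u u1; apply: Bpos; apply: contra_eq_neq u1 => ->.
  by rewrite enorm0 eq_sym oner_eq0.
have [u0|u0] := eqVneq (enorm u) 0.
  by rewrite u0 (enorm_eq0 u0) expr0n mulr0 /quadf mulmx0 mxE.
pose v := (enorm u)^-1 *: u.
have uE : u = enorm u *: v by rewrite scalerA divff// scale1r.
rewrite [in leRHS]uE quadfZ mulrC ler_wpM2l ?sqr_ge0//.
by apply: cB; rewrite enormZ ger0_norm ?invr_ge0 ?enorm_ge0// mulVf.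
Qed.

(** Take the subgradient inequality at the convex combination [z] and average it over [x] and [y]:
    the linear terms cancel. *)
Lemma subgradient_convex (R : realType) (n : nat) (f : 'cV[R]_n -> R) :
  (forall z, exists w, subgradient f z w) ->
  convex_function [set: 'cV[R]_n] f.
Proof.
move=> sub; apply/convex_functionP => t x y t0 t1.
set z := _ + _; have [w wz] := sub z.
have : t * (f z + dotv w (x - z)) + (1 - t) * (f z + dotv w (y - z))
    <= t * f x + (1 - t) * f y.
  by rewrite lerD// ler_wpM2l ?subr_ge0.
apply: le_trans; rewrite !mulrDr -!dotvZr addrACA -mulrDl subrKC mul1r -dotvDr.
have -> : t *: (x - z) + (1 - t) *: (y - z) = 0.
  by rewrite !scalerBr addrACA -opprD -scalerDl subrKC scale1r subrr.
by rewrite /dotv mulmx0 mxE addr0.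
Qed.

(** * Coercivity and strong convexity of [f] plus a quadratic penalty *)

Section penalized.
Variables (R : realType) (m p : nat) (D : 'M[R]_(m, p)) (f : 'cV[R]_p -> R).

Lemma penalized_continuous (rho : R) (b : 'cV[R]_m) :
  convex_function [set: 'cV[R]_p] f ->
  continuous (fun x => f x + rho / 2 * enorm (D *m x - b) ^+ 2).
Proof.
move=> /convex_continuous fc x; apply: (continuousD (fc x)).
apply: continuousM; first exact: cst_continuous.
exact: enorm_affine_continuous.
Qed.

(* On the unit sphere either [f (y + u) - f y] or [enorm (D *m u)] is bounded
   away from 0. *)
Lemma sphere_growth (y : 'cV[R]_p) :
  convex_function [set: 'cV[R]_p] f ->
  (forall u, D *m u = 0 -> u != 0 -> f y < f (y + u)) ->
  exists c K, [/\ 0 < c, 0 <= K & forall u, enorm u = 1 ->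
    c <= f (y + u) - f y + K * enorm (D *m u) ^+ 2].
Proof.
move=> cf ymin; pose a u := f (y + u) - f y; pose s u := enorm (D *m u) ^+ 2.
have ca : continuous a.
  have fc : continuous f := convex_continuous cf.
  move=> u; apply: continuousB; last exact: cst_continuous.
  apply: continuous_comp; last exact: fc.
  by apply: continuousD; [exact: cst_continuous|exact: cvg_id].
have cs : continuous s.
  have := @enorm_affine_continuous R m p D 0.
  by under eq_fun do rewrite subr0.
(* The maximum is positive on the sphere: [s u] is positive unless [D *m u = 0], and then [a u]
   is. *)
have cas : continuous (fun u => Num.max (a u) (s u)).
  by move=> u; apply: continuous_max; [exact: ca|exact: cs].
have [M [aM _]] := sphere_lower_bound ca.
have [c [cas_ge c0]] := sphere_lower_bound cas.
have {}c0 : 0 < c.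
  apply: c0 => u u1; rewrite lt_max.
  have [Du0|Du0] := eqVneq (D *m u) 0.
    rewrite subr_gt0 ymin//; apply: contra_eq_neq u1 => ->.
    by rewrite enorm0 eq_sym oner_eq0.
  rewrite exprn_gt0 ?orbT// lt0r enorm_ge0 andbT.
  by apply: contra_neq Du0; exact: enorm_eq0.
have K0 : 0 <= (c + `|M|) / c by rewrite divr_ge0 ?addr_ge0// ltW.
(* With this factor, [s u >= c] makes the second term at least [c + |M|], which offsets the worst
   value [M] of [a]. *)
exists c, ((c + `|M|) / c); split=> // u u1.
have s0 : 0 <= s u by exact: sqr_ge0.
have := cas_ge _ u1; rewrite le_max -/(a u) -/(s u) => /orP[ac|sc].
  by rewrite (le_trans ac)// lerDl mulr_ge0.
have : (c + `|M|) / c * c <= (c + `|M|) / c * s u by rewrite ler_wpM2l.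
rewrite divfK ?gt_eqF// => cMs.
have := aM _ u1; have := ler_norm (- M); rewrite normrN; lra.
Qed.

Lemma penalized_coercive (rho : R) (b : 'cV[R]_m) (y : 'cV[R]_p) :
  0 < rho -> convex_function [set: 'cV[R]_p] f ->
  (forall u, D *m u = 0 -> u != 0 -> f y < f (y + u)) ->
  coercive (fun x => f x + rho / 2 * enorm (D *m x - b) ^+ 2).
Proof.
move=> rho0 cf ymin; have [c [K [c0 K0 growth]]] := sphere_growth cf ymin.
move=> M; set B := enorm (D *m y - b) ^+ 2.
(* For [t >= tau], the three summands give in turn [1 <= t] for [convex_ray], [K <= t * rho / 4],
   and [t * c] large enough to reach [M] from [f y - rho / 2 * B]. *)
pose tau := 1 + 4 * K / rho + `|(M - f y + rho / 2 * B) / c|.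
have far x : tau <= enorm (x - y) ->
    M <= f x + rho / 2 * enorm (D *m x - b) ^+ 2.
  set t := enorm (x - y) => tau_t.
  have Kr0 : 0 <= 4 * K / rho by rewrite divr_ge0 ?mulr_ge0// ltW.
  have Kt : 4 * K / rho <= t.
    have := normr_ge0 ((M - f y + rho / 2 * B) / c); rewrite /tau in tau_t; lra.
  have Mt : (M - f y + rho / 2 * B) / c <= t.
    by apply: le_trans (ler_norm _) _; rewrite /tau in tau_t; lra.
  have t1 : 1 <= t.
    have := normr_ge0 ((M - f y + rho / 2 * B) / c); rewrite /tau in tau_t; lra.
  have t0 : 0 < t by rewrite (lt_le_trans _ t1).
  pose u := t^-1 *: (x - y).
  have u1 : enorm u = 1.
    by rewrite enormZ ger0_norm ?invr_ge0 ?enorm_ge0// mulVf// gt_eqF.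
  have xE : x = y + t *: u by rewrite scalerA divff ?gt_eqF// scale1r subrKC.
  have fx := convex_ray y u cf t1; rewrite -xE in fx.
  have := enormD_ge (t *: (D *m u)) (D *m y - b).
  rewrite enormZ exprMn (ger0_norm (ltW t0)) addrA scalemxAr -mulmxDr.
  rewrite [t *: u + y]addrC -xE -/B => Dx.
  have := growth _ u1; set s := enorm (D *m u) ^+ 2 in Dx *; set a := _ - f y.
  rewrite -/a in fx => au.
  have s0 : 0 <= s by exact: sqr_ge0.
  move: Kt; rewrite ler_pdivrMr// => Kt.
  move: Mt; rewrite ler_pdivrMr// => Mt.
  (* The penalty supplies [rho / 4 * t ^+ 2 * s], and [f] contributes at least [t * a] above [f y];
     together they exceed [t * (a + K * s)], hence [t * c]. *)
  have Kts : K * s <= t * rho / 4 * s by rewrite ler_wpM2r//; lra.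
  have ct : t * c <= t * (a + t * rho / 4 * s).
    by rewrite ler_wpM2l ?(ltW t0)//; lra.
  have rDx : rho / 2 * (t ^+ 2 * s / 2 - B) <=
      rho / 2 * enorm (D *m x - b) ^+ 2 by rewrite ler_wpM2l// divr_ge0// ltW.
  lra.
have tau0 : 0 <= tau.
  by rewrite !addr_ge0// divr_ge0 ?mulr_ge0// ltW.
near=> r => x rx; apply: far.
(* Distance from [y] is traded for distance from 0: [enormD_ge] asks for [enorm x ^+ 2] at least
   twice [tau ^+ 2 + enorm y ^+ 2], and [r <= r ^+ 2] turns this into a linear condition on [r]. *)
rewrite -(ler_pXn2r (n := 2))// ?nnegrE ?enorm_ge0//.
have := enormD_ge x (- y).
rewrite enormN.
have : 2 * (tau ^+ 2 + enorm y ^+ 2) + 1 <= r.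
  by near: r; apply: nbhs_pinfty_ge; exact: num_real.
have : r <= r ^+ 2.
  have r1 : 1 <= r by near: r; apply: nbhs_pinfty_ge; exact: num_real.
  by rewrite expr2 ler_peMl// (le_trans _ r1).
have : r ^+ 2 <= enorm x ^+ 2.
  have r0 : 0 <= r by near: r; apply: nbhs_pinfty_ge; exact: num_real.
  by rewrite ler_pXn2r// nnegrE// enorm_ge0.
lra.
Unshelve. all: end_near. Qed.

Lemma penalized_strongly_convex (A : 'M[R]_p) (rho : R) (b : 'cV[R]_m) :
  0 < rho -> (forall u, 0 <= quadf A u) ->
  (forall z, exists v, forall x,
    f z + dotv v (x - z) + 1 / 2 * quadf A (x - z) <= f x) ->
  (forall u, D *m u = 0 -> u != 0 -> 0 < quadf A u) ->
  strongly_convex (fun x => f x + rho / 2 * enorm (D *m x - b) ^+ 2).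
Proof.
move=> rho0 A0 fquad Apos.
have [u u0|mu mu0 muB] := @posdef_lower_bound _ _ (A + rho *: (D^T *m D)).
  rewrite quadf_add_gram; have [Du0|Du0] := eqVneq (D *m u) 0.
    by rewrite Du0 enorm0 expr0n mulr0 addr0 Apos.
  rewrite ltr_wpDl// mulr_gt0// exprn_gt0// lt0r enorm_ge0 andbT.
  by apply: contra_neq Du0; exact: enorm_eq0.
exists mu => //; apply: subgradient_convex => z; have [v vz] := fquad z.
(* This is [v] plus the gradients at [z] of the penalty and of [- mu / 2 * enorm z ^+ 2]. The
   second-order remainder is half of [quadf (A + rho *: (D^T *m D)) (x - z) - mu * enorm (x - z) ^+
   2], nonnegative by the choice of [mu]. *)
exists (v + rho *: (D^T *m (D *m z - b)) + - mu *: z) => x.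
rewrite !dotvDl !dotvZl -dotv_mulmxr.
have := vz x; have := muB (x - z); rewrite quadf_add_gram.
have -> : D *m x - b = (D *m z - b) + D *m (x - z).
  by rewrite mulmxBr addrAC subrKC.
have := enormD_sqr (D *m z - b) (D *m (x - z)) => ->.
have := enormD_sqr z (x - z); rewrite subrKC => ->; lra.
Qed.

End penalized.

Theorem proposition3p2 (R : realType) (m p : nat) (D : 'M[R]_(m, p))
    (S : set 'cV[R]_m) (T : set 'cV[R]_p) (f : 'cV[R]_p -> R)
    (S_closed : closed S) (S_convex : convex_set S)
    (T_def : T = [set x | S (D *m x)])
    (f_convex : convex_function [set: 'cV[R]_p] f)
    (f_min : exists! y, minimizer f T y) :
  (\forall rho \near +oo, forall xn : 'cV[R]_p,
     coercive (surrogate f D S rho xn) /\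
     exists y, minimizer (surrogate f D S rho xn) setT y)
  /\
  (forall A : 'M[R]_p,
     possemidef A ->
     (forall xn : 'cV[R]_p, exists vn : 'cV[R]_p,
        subgradient f xn vn /\
        forall x, f x >= f xn + dotv vn (x - xn) + 1 / 2 * quadf A (x - xn)) ->
     (forall u : 'cV[R]_p, enorm (D *m u) = 0 -> u != 0 -> quadf A u > 0) ->
     \forall rho \near +oo, forall xn : 'cV[R]_p,
       strongly_convex (surrogate f D S rho xn) /\
       coercive (surrogate f D S rho xn)).
Proof.
have [y [[Ty ymin] yuniq]] := f_min.
have f_incr u : D *m u = 0 -> u != 0 -> f y < f (y + u).
  move=> Du0 u0; have T_add x : T x -> T (x + u).
    by rewrite T_def /= mulmxDr Du0 addr0.
  (* Without strict increase, [y + u] would be a second minimizer on [T]. *)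
  rewrite ltNge; apply: contra_neqN u0 => fyu.
  have /yuniq/eqP : minimizer f T (y + u).
    by split=> [|x Tx]; [exact: T_add|exact: le_trans fyu (ymin _ Tx)].
  by rewrite eq_sym -subr_eq0 addrC addKr => /eqP.
(* The projected point plays the role of [b], so the threshold on [rho] is the same for every
   [xn]. *)
have coer rho xn : 0 < rho -> coercive (surrogate f D S rho xn).
  by move=> rho0; exact: penalized_coercive f_incr.
split=> [|A [_ A0] f_quad A_pos].
  near=> rho => xn; have rho0 : 0 < rho.
    by near: rho; apply: nbhs_pinfty_gt; exact: num_real.
  split; first exact: coer.
  by apply: coercive_minimizer; [exact: penalized_continuous|exact: coer].
near=> rho => xn; have rho0 : 0 < rho.
  by near: rho; apply: nbhs_pinfty_gt; exact: num_real.
split; last exact: coer.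
apply: (penalized_strongly_convex _ rho0 A0) => [z|u Du0].
  by have [v [_ vz]] := f_quad z; exists v.
by apply: A_pos; rewrite Du0 enorm0.
Unshelve. all: end_near. Qed.
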